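(* Let $X$ be a random variable with probability mass function $$f(k)=(1-\rho(k))\prod_{s=1}^{k-1}\rho(s),\qquad k=1,2,\ldots,T,$$ where $T$, $\rho$ are as in the context. Then $X$ has moment generating function $$M_X(t)=\sum_{k=1}^{T-1}\left(e^{t(k+1)}-e^{tk}\right)\prod_{s=1}^{k}\rho(s)+e^t.$$ The $n$-th derivatives are $$M_X^{(n)}(t)=\sum_{k=1}^{T-1}\left((k+1)^n e^{t(k+1)}-k^n e^{tk}\right)\prod_{s=1}^{k}\rho(s)+e^t.$$ So $$\mathrm{E}(X^n)=M_X^{(n)}(0)=\sum_{k=1}^{T-1}\left((k+1)^n-k^n\right)\prod_{s=1}^{k}\rho(s)+1,$$ and then $$\mathrm{E}(X)=\sum_{k=1}^{T-1}\prod_{s=1}^{k}\rho(s)+1,$$ $$\mathrm{Var}(X)=\mathrm{E}(X)+2\sum_{k=1}^{T-1}k\prod_{s=1}^{k}\rho(s)-\mathrm{E}(X)^2.$$ The probability generating function is $$P_X(z)=\sum_{k=1}^{T-1}\left(z^{k+1}-z^k\right)\prod_{s=1}^{k}\rho(s)+z,$$ with $n$-th derivatives $$P_X^{(n)}(z)=\sum_{k=n}^{T-1}\left(\frac{(k+1)!\,z^{k+1-n}}{(k+1-n)!}-\frac{k!\,z^{k-n}}{(k-n)!}\right)\prod_{s=1}^{k}\rho(s)+\frac{d^n z}{dz^n}.$$ The factorial moments are $$\mathrm{E}\big(X(X-1)\cdots(X-n+1)\big)=P_X^{(n)}(1)=\sum_{k=n}^{T-1}\frac{k!\,n}{(k+1-n)!}\prod_{s=1}^{k}\rho(s)+\frac{d^n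 z}{dz^n}.$$
   Context: $T$ is a positive integer (which may be allowed to go to $\infty$), $\rho(1),\rho(2),\ldots,\rho(T-1)\in(0,1]$, and $\rho(T)=0$. Empty products equal $1$. Here $n\ge1$ is an integer, $M_X(t)=\mathrm{E}(e^{tX})$ and $P_X(z)=\mathrm{E}(z^X)$ are the moment and probability generating functions, and superscript $(n)$ denotes the $n$-th derivative. The term $\frac{d^n z}{dz^n}$ is the $n$-th derivative of the function $z$, i.e. $1$ for $n=1$ and $0$ for $n\ge2$.
   Formalization: For n≥2 the printed formulas for P_X^(n)(z) and the factorial moments omit the k=n−1 term; n!·∏_{s=1}^{n−1}ρ(s) is added to both. For T=∞ the derivative, variance and P_X formulas are stated where the generating functions (near the point) or E(X) are finite. *)

(* Defs.v *)
From HB Require Import structures.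
From mathcomp Require Import all_boot all_order all_algebra.
From mathcomp Require Import all_classical all_reals all_analysis.
Set Implicit Arguments.
Unset Strict Implicit.
Unset Printing Implicit Defensive.
Import Order.TTheory GRing.Theory Num.Theory.
Import numFieldNormedType.Exports.
Local Open Scope ring_scope.

(* The horizon T is an [option nat]: [Some N] is T = N and [None] is T = oo. *)
Definition before (T : option nat) (k : nat) : bool :=
  if T is Some N then (k < N)%N else true.

Definition upto (T : option nat) (k : nat) : bool :=
  if T is Some N then (k <= N)%N else true.

(* The sum of F k over m <= k <= T - 1.  It is a finite sum of reals for finite
   T, and the limit of the partial sums in the extended reals for T = oo. *)
Definition hsum (R : realType) (T : option nat) (m : nat) (F : nat -> R) :
    \bar R :=
  if T is Some N then (\sum_(m <= k < N) F k)%:E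
  else (\sum_(m <= k <oo) (F k)%:E)%E.

(* [hsum] has a junk value for a divergent series of arbitrary sign; this
   predicate rules that out (it says nothing when T is finite). *)
Definition hcvg (R : realType) (T : option nat) (m : nat) (F : nat -> R) :
    Prop :=
  T = None -> cvgn (fun N : nat => \sum_(m <= k < N) F k).

Definition prodrho (R : realType) (rho : nat -> R) (k : nat) : R :=
  \prod_(1 <= s < k.+1) rho s.

Definition hazard_pmf (R : realType) (T : option nat) (rho : nat -> R)
    (k : nat) : R :=
  if (1 <= k)%N && upto T k then (1 - rho k) * \prod_(1 <= s < k) rho s else 0.

Definition pgf d (Omega : measurableType d) (R : realType)
    (P : probability Omega R) (X : Omega -> nat) (z : R) : \bar R :=
  ('E_P[fun w => (z ^+ X w)%R])%E.

(* The n-th derivative of (z^(k+1) - z^k) prodrho k does not vanish for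
   k = n - 1: it is n! prodrho (n - 1).  A sum over k >= n omits this term,
   which is a genuine term of the series (k >= 1) as soon as n >= 2. *)
Definition boundary_term (R : realType) (rho : nat -> R) (n : nat) : R :=
  if (2 <= n)%N then n`!%:R * prodrho rho n.-1 else 0.

(* Main.v *)
(* Summation by parts.  With S k = rho 1 ... rho k one has
   P(X = k) = S (k - 1) - S k and P(X > k) = S k (so S tends to 0, P being a
   probability), whence
     E h(X) = h 1 + sum_(k >= 1) (h (k + 1) - h k) S k
   as soon as the boundary term h (k + 1) S k is under control.  This holds in
   the extended reals when h is nonnegative and nondecreasing, by squeezing the
   partial sums; it also holds when |h k| <= C r^k and E r^X is finite, since
   then S k r^k tends to 0.  Derivatives of the generating functions are obtained
   termwise from the power series sum_k P(X = k) z^k, so that each of them is an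
   expectation E h(X) of the second kind. *)
Require Import Defs.
From HB Require Import structures.
From mathcomp Require Import all_boot all_order all_algebra.
From mathcomp Require Import all_classical all_reals all_analysis.
From mathcomp Require Import measurable_realfun ring lra.
Set Implicit Arguments.
Unset Strict Implicit.
Unset Printing Implicit Defensive.
Import Order.TTheory GRing.Theory Num.Theory.
Import numFieldNormedType.Exports.
Local Open Scope classical_set_scope.
Local Open Scope ring_scope.

(** * Polynomial factors against geometric growth *)

(** Cleared of its denominator, the bound follows by induction: the old part gains a factor [x], the
    new part [x ^+ k.+1 * (r - x)] is at most [x * r ^+ k * (r - x)], and [x + (r - x) = r]. *)
Lemma natmul_exp_le (R : realFieldType) (x r : R) (k : nat) : 0 <= x -> x < r ->
  k%:R * x ^+ k <= x / (r - x) * r ^+ k.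
Proof.
move=> x0 xr; have rx : 0 < r - x by rewrite subr_gt0.
rewrite mulrAC ler_pdivlMr//.
elim: k => [|k ih]; first by rewrite !mul0r expr0 mulr1.
have xrk : x * x ^+ k <= x * r ^+ k.
  by rewrite ler_wpM2l//; apply: lerXn2r => //; rewrite ?nnegrE ltW// (le_lt_trans x0).
rewrite !exprS -natr1.
have {}ih := ler_wpM2l x0 ih.
have := ler_wpM2r (ltW rx) xrk.
by rewrite /= in ih *; lra.
Qed.

(** Each factor [k] is absorbed by enlarging the base from [x] to the midpoint of [x] and [r], which
    leaves room for the remaining factors. *)
Lemma natexp_exp_le (R : realFieldType) (x r : R) (n : nat) : 0 <= x -> x < r ->
  exists C, forall k : nat, k%:R ^+ n * x ^+ k <= C * r ^+ k.
Proof.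
elim: n x => [|n ih] x x0 xr.
  exists 1 => k; rewrite expr0 !mul1r.
  by apply: lerXn2r => //; rewrite ?nnegrE ltW// (le_lt_trans x0).
have xy : x < (x + r) / 2 by lra.
have yr : (x + r) / 2 < r by lra.
have y0 : 0 <= (x + r) / 2 by lra.
have [C HC] := ih _ y0 yr.
exists (x / ((x + r) / 2 - x) * C) => k.
have D0 : 0 <= x / ((x + r) / 2 - x) by rewrite divr_ge0// subr_ge0 ltW.
rewrite exprSr -mulrA; apply: le_trans (ler_wpM2l _ (natmul_exp_le k x0 xy)) _.
  by rewrite exprn_ge0.
by rewrite mulrCA -mulrA ler_wpM2l.
Qed.

(** * Termwise differentiation of power series *)

Lemma cvg_series_shift (R : realType) (u : R ^nat) :
  cvgn (series u) -> cvgn (series (fun k => u k.+1)).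
Proof.
move=> /cvg_ex[/= l]; rewrite -cvg_shiftS => ul; apply/cvg_ex; exists (l - u 0%N) => /=.
have -> : series (fun k => u k.+1) = (fun n => series u n.+1 - u 0%N).
  by apply/funext => n; rewrite /series/= big_nat_recl// addrAC subrr add0r.
by apply: cvgB => //; exact: cvg_cst.
Qed.

(** The gap between [|x|] and [r] absorbs the factor [k.+1], so the differentiated series converges
    on the same open disc and the lemma can be iterated. *)
Lemma is_cvg_pseries_diffs_inside (R : realType) (a : R ^nat) (r : R) :
  (forall x, `|x| < r -> cvgn (pseries a x)) ->
  forall x, `|x| < r -> cvgn (pseries (pseries_diffs a) x).
Proof.
move=> ca x xr.
(* Convergence at [z] gives absolute convergence at the smaller [y], and the gap from [|x|] to [y]
   pays for the differentiation. *)
pose y := (`|x| + r) / 2; pose z := (y + r) / 2.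
have xy : `|x| < y by rewrite /y; lra.
have yz : y < z by rewrite /z /y; lra.
have zr : z < r by rewrite /z /y; lra.
have y0 : 0 <= y by rewrite (le_trans _ (ltW xy)).
have z0 : 0 <= z by rewrite (le_trans y0)// ltW.
have cy : cvgn (pseries (fun i => `|a i|) y).
  by apply: is_cvg_pseries_inside_norm (ca z _) _; rewrite ger0_norm// ger0_norm.
have cyS := is_cvg_seriesZ (k := (y - `|x|)^-1) (cvg_series_shift cy).
apply: normed_cvg; apply: series_le_cvg cyS => [k|k|k] /=; first exact: normr_ge0.
  by rewrite mulr_ge0 ?invr_ge0 ?subr_ge0 ?(ltW xy)// mulr_ge0// exprn_ge0.
(* Multiplied by [y - |x|], the part with [k] is at most [|x| * y ^+ k] and the remaining one at
   most [y ^+ k * (y - |x|)]; they add up to [y ^+ k.+1]. *)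
have key : k.+1%:R * `|x| ^+ k <= (y - `|x|)^-1 * y ^+ k.+1.
  rewrite [leRHS]mulrC ler_pdivlMr ?subr_gt0//.
  have := natmul_exp_le k (normr_ge0 x) xy.
  rewrite mulrAC ler_pdivlMr ?subr_gt0// exprS.
  have : `|x| ^+ k <= y ^+ k by apply: lerXn2r => //; rewrite ?nnegrE// ltW.
  move=> /(ler_wpM2r _); move/(_ (y - `|x|)).
  by rewrite subr_ge0 (ltW xy) => /(_ isT); rewrite -natr1; lra.
rewrite /pseries_diffs !normrM normr_nat normrX [X in X * _]mulrC -mulrA.
apply: (le_trans (ler_wpM2l (normr_ge0 _) key)).
by rewrite mulrCA.
Qed.

(** [pseries_snd_diffs] asks for convergence of the series and of its first two formal derivatives
    at a point of larger modulus; the midpoint of [|x|] and [r] serves. *)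
Lemma is_derive_pseries (R : realType) (a : R ^nat) (r : R) :
  (forall x, `|x| < r -> cvgn (pseries a x)) ->
  forall x : R, `|x| < r ->
  is_derive x 1 (fun x => limn (pseries a x)) (limn (pseries (pseries_diffs a) x)).
Proof.
move=> ca x xr; have y0 : 0 <= (`|x| + r) / 2 by have := normr_ge0 x; lra.
have xy : `|x| < `|(`|x| + r) / 2| by rewrite (ger0_norm y0); lra.
have yr : `|(`|x| + r) / 2| < r by rewrite (ger0_norm y0); lra.
have ca1 := is_cvg_pseries_diffs_inside ca.
have ca2 := is_cvg_pseries_diffs_inside ca1.
exact: (pseries_snd_diffs (ca _ yr) (ca1 _ yr) (ca2 _ yr) xy).
Qed.

(** Agreement on an open set is agreement near each of its points, so it survives differentiation
    and the induction goes on. *)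
Lemma derive1n_open (R : realType) (U : set R) (f : R -> R) (g : nat -> R -> R) :
  open U -> (forall x, U x -> f x = g 0%N x) ->
  (forall n (x : R), U x -> is_derive x 1 (g n) (g n.+1 x)) ->
  forall n x, U x -> derive1n n f x = g n x /\ derivable (derive1n n f) x 1.
Proof.
move=> oU fg dg n.
suff H x : U x -> derive1n n f x = g n x.
  move=> x Ux; split; first exact: H.
  have nU : \near x, g n x = derive1n n f x.
    by apply: filterS (open_nbhs_nbhs (conj oU Ux)) => y Uy; rewrite H.
  by have [] := near_eq_is_derive nU (dg n _ Ux).
elim: n x => [|n ih] x Ux; first exact: fg.
rewrite derive1nS derive1E.
have nU : \near x, g n x = derive1n n f x.
  by apply: filterS (open_nbhs_nbhs (conj oU Ux)) => y Uy; rewrite ih.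
by have [_] := near_eq_is_derive nU (dg n _ Ux).
Qed.

(** * Summation by parts against a survival sequence *)

(* [c] is a mass function on the positive integers and [S k] the mass of
   [k.+1, +oo[. *)
Definition survival (R : realType) (c S : R ^nat) : Prop :=
  [/\ S 0%N = 1, c 0%N = 0, forall k, c k.+1 = S k - S k.+1,
      forall k, 0 <= c k & S @ \oo --> 0].

Lemma survival_nonincreasing (R : realType) (c S : R ^nat) : survival c S ->
  nonincreasing_seq S.
Proof.
case=> _ _ cS c0 _; apply/nonincreasing_seqP => k.
by rewrite -subr_ge0 -cS.
Qed.

Lemma survival_ge0 (R : realType) (c S : R ^nat) : survival c S ->
  forall k, 0 <= S k.
Proof.
move=> cS k; case: (cS) => _ _ _ _ S0.
rewrite -(cvg_lim _ S0)//; apply: nonincreasing_cvgn_ge.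
  exact: survival_nonincreasing cS.
by apply/cvg_ex; exists 0.
Qed.

(** The value [h 0] drops out since [c 0 = 0], and [S 0 = 1] gives [h 1] the coefficient one. *)
Lemma abel_sum (R : realType) (c S h : R ^nat) (n : nat) : survival c S ->
  \sum_(0 <= k < n.+1) c k * h k =
  h 1%N + \sum_(1 <= k < n.+1) (h k.+1 - h k) * S k - h n.+1 * S n.
Proof.
case=> S0 c0 cS _ _; elim: n => [|n ih].
  by rewrite big_nat1 big_geq// S0 c0; ring.
by rewrite big_nat_recr//= ih [in RHS]big_nat_recr//= cS; ring.
Qed.

(** The mass carried by the indices from [n.+1] to [m] is [S n - S m], and there [h] is at least
    [h n.+1]. *)
Lemma sum_monotone_le (R : realType) (c S h : R ^nat) (n m : nat) :
  survival c S -> (forall k, h k <= h k.+1) -> (n <= m)%N ->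
  \sum_(0 <= k < n.+1) c k * h k + h n.+1 * (S n - S m) <=
  \sum_(0 <= k < m.+1) c k * h k.
Proof.
move=> [_ _ cS c0 _] hn nm; have hnd : nondecreasing_seq h.
  exact/nondecreasing_seqP.
rewrite -(subnKC nm); elim: (m - n)%N => [|p ih].
  by rewrite addn0 subrr mulr0 addr0.
rewrite addnS [leRHS]big_nat_recr//=.
have : h n.+1 * c (n + p).+1 <= c (n + p).+1 * h (n + p).+1.
  by rewrite mulrC ler_wpM2l// hnd// ltnS leq_addr.
by rewrite cS; move: ih; lra.
Qed.

(** The transformed partial sum is squeezed between the direct partial sum, which lacks the
    nonnegative boundary term, and the full series, whose tail dominates that term. *)
Lemma abel_nondecreasing (R : realType) (c S h : R ^nat) : survival c S ->
  (forall k, 0 <= h k) -> (forall k, h k <= h k.+1) ->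
  (h 1%N + \sum_(1 <= k < n) (h k.+1 - h k) * S k)%:E @[n --> \oo] -->
  (\sum_(0 <= k <oo) (c k * h k)%:E)%E.
Proof.
move=> cS h0 hn; case: (cS) => _ _ _ c0 Soo.
have ch0 k : (0 <= (c k * h k)%:E)%E by rewrite lee_fin mulr_ge0.
have S_ge0 := survival_ge0 cS.
have leL m : ((\sum_(0 <= k < m) c k * h k)%:E <=
    \sum_(0 <= k <oo) (c k * h k)%:E)%E.
  by rewrite -sumEFin; apply: nneseries_lim_ge.
rewrite -cvg_shiftS; apply: (@squeeze_cvge _ _ _ _
  (fun n => (\sum_(0 <= k < n.+1) c k * h k)%:E) _ (fun=> \sum_(0 <= k <oo) (c k * h k)%:E)%E).
- near=> n; apply/andP; split.
    by rewrite lee_fin (abel_sum h n cS) gerBl// mulr_ge0.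
  case L : (\sum_(0 <= k <oo) (c k * h k)%:E)%E leL => [l| |] leL.
  (* For a finite total, the excess of the transformed sum over [l] is at most [h n.+1 * S m] for
     every [m >= n], and this tends to 0 with [m]. *)
  + rewrite lee_fin -subr_le0.
    apply: (@cvgr_to_ge nat \oo _ R (fun m => h n.+1 * S m)).
      by rewrite -(mulr0 (h n.+1)); apply: cvgMl_tmp.
    near=> m; have nm : (n <= m)%N by near: m; exact: nbhs_infty_ge.
    have := sum_monotone_le cS hn nm; rewrite (abel_sum h n cS).
    by have := leL m.+1; rewrite lee_fin; lra.
  + exact: leey.
  + by have := leL 0%N; rewrite leeNy_eq.
- rewrite (@cvg_shiftS _ (fun n => (\sum_(0 <= k < n) c k * h k)%:E)).
  have -> : (fun n => (\sum_(0 <= k < n) c k * h k)%:E) =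
            (fun n => \sum_(0 <= k < n) (c k * h k)%:E)%E.
    by apply/funext => n; rewrite sumEFin.
  exact: is_cvg_nneseries.
- exact: cvg_cst.
Unshelve. all: by end_near. Qed.

Lemma cvg_series_nneseries (R : realType) (u : R ^nat) : (forall k, 0 <= u k) ->
  cvgn (series u) -> (\sum_(0 <= k <oo) (u k)%:E)%E = (limn (series u))%:E.
Proof.
move=> u0 cu; rewrite -EFin_lim//; apply/congr_lim/funext => n /=.
by rewrite sumEFin.
Qed.

Lemma nneseries_cvg_series (R : realType) (u : R ^nat) : (forall k, 0 <= u k) ->
  (\sum_(0 <= k <oo) (u k)%:E < +oo)%E -> cvgn (series u).
Proof.
move=> u0 uoo; apply: nondecreasing_is_cvgn.
  by apply/nondecreasing_seqP => n; rewrite /series/= big_nat_recr//= lerDl.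
exists (fine (\sum_(0 <= k <oo) (u k)%:E)%E) => _ [n _ <-].
have u0E k : (0 <= (u k)%:E)%E by rewrite lee_fin.
rewrite -lee_fin fineK; last by rewrite ge0_fin_numE// nneseries_ge0.
by rewrite /series/= -sumEFin; apply: nneseries_lim_ge.
Qed.

(** For [r < 1] it suffices that [S <= 1]. For [r >= 1] the powers are nondecreasing, so the direct
    and the transformed partial sums share a finite limit, and their difference is the boundary term
    [r ^+ n.+1 * S n]. *)
Lemma cvg_survival_exp (R : realType) (c S : R ^nat) (r : R) : survival c S ->
  0 <= r -> cvgn (pseries c r) -> S n * r ^+ n @[n --> \oo] --> 0.
Proof.
move=> cS r0 cr; case: (cS) => S0 _ _ c0 Soo.
have Sge0 := survival_ge0 cS.
have Sle1 k : S k <= 1.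
  by rewrite -S0; apply: (survival_nonincreasing cS).
have [r1|r1] := ltP r 1.
  apply: (@squeeze_cvgr _ _ _ _ (fun=> 0) (fun n => r ^+ n)).
  - by near=> n; rewrite mulr_ge0 ?exprn_ge0//= ler_piMl// exprn_ge0.
  - exact: cvg_cst.
  - by apply: cvg_expr; rewrite ger0_norm.
have h0 k : 0 <= r ^+ k by rewrite exprn_ge0.
have hn k : r ^+ k <= r ^+ k.+1 by rewrite exprS ler_peMl.
have /= := abel_nondecreasing cS h0 hn.
rewrite (@cvg_series_nneseries _ (fun k => c k * r ^+ k))//; last first.
  by move=> k; rewrite mulr_ge0.
move=> /fine_cvg; rewrite -cvg_shiftS => /= B.
have A : series (fun k => c k * r ^+ k) n.+1 @[n --> \oo] -->
    limn (series (fun k => c k * r ^+ k)) by rewrite cvg_shiftS.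
have BA : r ^+ n.+1 * S n @[n --> \oo] --> 0.
  have -> : (fun n => r ^+ n.+1 * S n) =
      (fun n => (r ^+ 1 + \sum_(1 <= k < n.+1) (r ^+ k.+1 - r ^+ k) * S k) -
                series (fun k => c k * r ^+ k) n.+1).
    apply/funext => n; rewrite /series/= (abel_sum (fun k => r ^+ k) n cS).
    by rewrite opprB addrCA subrr addr0.
  rewrite -[X in _ --> X](subrr (limn (series (fun k => c k * r ^+ k)))).
  exact: cvgB B A.
apply: (squeeze_cvgr _ (cvg_cst 0) BA).
near=> n; rewrite mulr_ge0//= exprS mulrC.
by rewrite ler_wpM2r// ler_peMl.
Unshelve. all: by end_near. Qed.

Lemma cvg_series_dominated (R : realType) (c h : R ^nat) (r C : R) :
  (forall k, 0 <= c k) -> 0 <= r -> cvgn (pseries c r) ->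
  (forall k, `|h k| <= C * r ^+ k) ->
  cvgn (series (fun k => `|c k * h k|)) /\ cvgn (series (fun k => c k * h k)).
Proof.
move=> c0 r0 cr hC.
have C0 : 0 <= C.
  by apply: le_trans (normr_ge0 (h 0%N)) _; have := hC 0%N; rewrite expr0 mulr1.
have N : cvgn (series (fun k => `|c k * h k|)).
  apply: series_le_cvg (is_cvg_seriesZ (k := C) cr) => k //=.
    by rewrite mulr_ge0// mulr_ge0// exprn_ge0.
  rewrite normrM ger0_norm//; apply: (le_trans (ler_wpM2l (c0 k) (hC k))).
  by rewrite mulrCA.
by split => //; exact: normed_cvg.
Qed.

(** The boundary term is at most [C * r * (S n * r ^+ n)] in absolute value, which tends to 0; no
    sign or monotonicity of [h] enters. *)
Lemma abel_dominated (R : realType) (c S h : R ^nat) (r C : R) : survival c S ->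
  0 <= r -> cvgn (pseries c r) -> (forall k, `|h k| <= C * r ^+ k) ->
  h 1%N + \sum_(1 <= k < n) (h k.+1 - h k) * S k @[n --> \oo] -->
  limn (series (fun k => c k * h k)).
Proof.
move=> cS r0 cr hC; case: (cS) => S0 _ _ c0 Soo.
have [_ cv] := cvg_series_dominated c0 r0 cr hC.
have tail : h n.+1 * S n @[n --> \oo] --> 0.
  apply/norm_cvg0P; apply: (@squeeze_cvgr _ _ _ _ (fun=> 0) (fun n => C * r * (S n * r ^+ n))).
  - near=> n; rewrite normr_ge0/= normrM (ger0_norm (survival_ge0 cS n)).
    apply: (le_trans (ler_wpM2r (survival_ge0 cS n) (hC _))).
    by rewrite exprS -!mulrA (mulrC (S n)).
  - exact: cvg_cst.
  - rewrite -(mulr0 (C * r)); apply: cvgMl_tmp.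
    exact: cvg_survival_exp cS r0 cr.
rewrite -cvg_shiftS.
have -> : [sequence h 1%N + \sum_(1 <= k < n.+1) (h k.+1 - h k) * S k]_n =
    (fun n => series (fun k => c k * h k) n.+1 + h n.+1 * S n).
  by apply/funext => n; rewrite /series/= (abel_sum h n cS) subrK.
have cvS : series (fun k => c k * h k) n.+1 @[n --> \oo] -->
    limn (series (fun k => c k * h k)) by rewrite cvg_shiftS.
by have /(_ eventually_filter) := cvgD cvS tail; rewrite addr0.
Unshelve. all: by end_near. Qed.

(** * Higher derivatives of the generating series *)

Lemma iter_pseries_diffsE (R : realType) (c : R ^nat) (n j : nat) :
  iter n (@pseries_diffs R) c j = ((j + n) ^_ n)%:R * c (j + n)%N.
Proof.
elim: n j => [|n ih] j; first by rewrite addn0 ffactn0 mul1r.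
rewrite iterS /pseries_diffs ih addSnnS mulrA -natrM mulnC; congr (_%:R * _).
by rewrite ffactnSr -addSnnS addnK.
Qed.

(** The falling factorial vanishes for [k < n], where the truncated [k - n] is meaningless; what
    remains is the iterated formal derivative with its index shifted by [n]. *)
Lemma limn_series_ffact (R : realType) (c : R ^nat) (n : nat) (x : R) :
  cvgn (pseries (iter n (@pseries_diffs R) c) x) ->
  limn (series (fun k => c k * ((k ^_ n)%:R * x ^+ (k - n)))) =
  limn (pseries (iter n (@pseries_diffs R) c) x).
Proof.
move=> cv; apply/cvg_lim => //; rewrite -(cvg_shiftn n).
have -> // : [sequence series (fun k => c k * ((k ^_ n)%:R * x ^+ (k - n))) (m + n)%N]_m
  = pseries (iter n (@pseries_diffs R) c) x.
apply/funext => m; rewrite /pseries /series/= (@big_cat_nat _ _ _ n)//= ?leq_addl//.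
rewrite big_nat big1 ?add0r => [|k /andP[_ kn]]; last first.
  by rewrite ffact_small// mul0r mulr0.
rewrite -{1}[n]add0n big_addn addnK; apply: eq_bigr => j _.
by rewrite iter_pseries_diffsE addnK mulrCA mulrA.
Qed.

Lemma is_derive_series_ffact (R : realType) (c : R ^nat) (r : R) (n : nat) (x : R) :
  (forall y : R, `|y| < r -> cvgn (pseries c y)) -> `|x| < r ->
  is_derive x 1 (fun y => limn (series (fun k => c k * ((k ^_ n)%:R * y ^+ (k - n)))))
    (limn (series (fun k => c k * ((k ^_ n.+1)%:R * x ^+ (k - n.+1))))).
Proof.
move=> cc xr.
have ci m : forall y : R, `|y| < r -> cvgn (pseries (iter m (@pseries_diffs R) c) y).
  by elim: m => [//|m ih]; exact: is_cvg_pseries_diffs_inside.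
rewrite limn_series_ffact; last exact: ci.
apply: near_eq_is_derive (is_derive_pseries (ci n) xr).
have oU : open [set y : R | `|y| < r].
  by apply: open_comp (@open_lt _ r) => y _; exact: norm_continuous.
apply: filterS (open_nbhs_nbhs (conj oU xr)) => y /= yr.
by rewrite limn_series_ffact//; exact: ci.
Qed.

(** Chain rule through [x = expR u]. The inner derivative [expR t] restores the exponent lowered by
    [pseries_diffs], and the term of index 0 is zero. *)
Lemma is_derive_series_expR (R : realType) (c : R ^nat) (r : R) (t : R) :
  (forall y : R, `|y| < r -> cvgn (pseries c y)) -> expR t < r ->
  is_derive t 1 (fun u => limn (series (fun k => c k * expR (u * k%:R))))
    (limn (series (fun k => k%:R * c k * expR (t * k%:R)))).
Proof.
move=> cc tr.
have -> : (fun u => limn (series (fun k => c k * expR (u * k%:R)))) =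
          (fun x => limn (pseries c x)) \o @expR R.
  apply/funext => u; rewrite /pseries/=; congr (limn (series _)).
  by apply/funext => k; rewrite expRM_natr.
have tr' : `|expR t| < r by rewrite ger0_norm ?expR_ge0.
have dc := is_cvg_pseries_diffs_inside cc tr'.
have -> : limn (series (fun k => k%:R * c k * expR (t * k%:R))) =
          limn (pseries (pseries_diffs c) (expR t)) * expR t.
  apply/cvg_lim => //; rewrite -cvg_shiftS.
  have -> : [sequence series (fun k => k%:R * c k * expR (t * k%:R)) m.+1]_m =
      (fun m => pseries (pseries_diffs c) (expR t) m * expR t).
    apply/funext => m; rewrite /pseries /series/= big_nat_recl// !mul0r add0r.
    rewrite mulr_suml; apply: eq_bigr => k _.
    by rewrite expRM_natr exprSr mulrA.
  exact: cvgMr_tmp dc.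
by apply: is_derive1_comp; exact: is_derive_pseries tr'.
Qed.

Lemma derive1n_series_ffact (R : realType) (c : R ^nat) (f : R -> R) (r : R)
    (n : nat) (x : R) :
  (forall y : R, `|y| < r -> cvgn (pseries c y)) ->
  (forall y : R, `|y| < r -> f y = limn (pseries c y)) -> `|x| < r ->
  derive1n n f x = limn (series (fun k => c k * ((k ^_ n)%:R * x ^+ (k - n)))) /\
  derivable (derive1n n f) x 1.
Proof.
move=> cc fc xr.
apply: (@derive1n_open _ [set y : R | `|y| < r] f
  (fun n y => limn (series (fun k => c k * ((k ^_ n)%:R * y ^+ (k - n)))))) => //.
- by apply: open_comp (@open_lt _ r) => y _; exact: norm_continuous.
- move=> y /= yr; rewrite fc//; congr (limn (series _)).
  by apply/funext => k; rewrite ffactn0 mul1r subn0.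
- by move=> m y /= yr; exact: is_derive_series_ffact yr.
Qed.

Lemma derive1n_series_expR (R : realType) (c : R ^nat) (f : R -> R) (r : R)
    (n : nat) (t : R) : (forall k, 0 <= c k) ->
  (forall y : R, `|y| < r -> cvgn (pseries c y)) ->
  (forall u : R, expR u < r -> f u = limn (series (fun k => c k * expR (u * k%:R)))) ->
  expR t < r ->
  derive1n n f t =
    limn (series (fun k => c k * (k%:R ^+ n * expR (t * k%:R)))) /\
  derivable (derive1n n f) t 1.
Proof.
move=> c0 cc fc tr.
apply: (@derive1n_open _ [set u : R | expR u < r] f
  (fun n u => limn (series (fun k => c k * (k%:R ^+ n * expR (u * k%:R)))))) => //.
- by apply: open_comp (@open_lt _ r) => y _; exact: continuous_expR.
- move=> u /= ur; rewrite fc//; congr (limn (series _)).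
  by apply/funext => k; rewrite mul1r.
- move=> m u /= ur.
  (* The weights [k%:R ^+ m] leave the disc of convergence unchanged, so each further derivative is
     a first derivative with new coefficients. *)
  have cm y : `|y| < r -> cvgn (pseries (fun k => k%:R ^+ m * c k) y).
    move=> yr; have yz : `|y| < (`|y| + r) / 2 by lra.
    have z0 : 0 <= (`|y| + r) / 2 := le_trans (normr_ge0 y) (ltW yz).
    have [C HC] := natexp_exp_le m (normr_ge0 y) yz.
    have zr : `|(`|y| + r) / 2| < r by rewrite (ger0_norm z0); lra.
    have hC k : `|k%:R ^+ m * y ^+ k| <= C * ((`|y| + r) / 2) ^+ k.
      by rewrite normrM !normrX normr_nat.
    have [_] := cvg_series_dominated c0 z0 (cc _ zr) hC.
    rewrite /pseries; by congr (cvgn (series _)); apply/funext => k; rewrite mulrCA mulrA.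
  have -> : (fun u => limn (series (fun k => c k * (k%:R ^+ m * expR (u * k%:R))))) =
      (fun u => limn (series (fun k => k%:R ^+ m * c k * expR (u * k%:R)))).
    apply/funext => v; congr (limn (series _)).
    by apply/funext => k; rewrite mulrCA mulrA.
  have -> : limn (series (fun k => c k * (k%:R ^+ m.+1 * expR (u * k%:R)))) =
      limn (series (fun k => k%:R * (k%:R ^+ m * c k) * expR (u * k%:R))).
    congr (limn (series _)).
    by apply/funext => k; rewrite mulrCA exprS !mulrA.
  exact: is_derive_series_expR cm ur.
Qed.

(** * Expectations as series over the fibres of [X] *)

Lemma measurable_natRV_comp (d : measure_display) (Omega : measurableType d)
    (R : realType) (P : probability Omega R) (X : {RV P >-> nat}) (h : R ^nat) :
  measurable_fun setT (h \o X).
Proof. by apply: measurableT_comp. Qed.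

Lemma bigcup_natRV (d : measure_display) (Omega : measurableType d)
    (R : realType) (P : probability Omega R) (X : {RV P >-> nat}) :
  \bigcup_k (X @^-1` [set k]) = [set: Omega].
Proof. by apply/seteqP; split => // w _; exists (X w). Qed.

Lemma trivIset_natRV (d : measure_display) (Omega : measurableType d)
    (R : realType) (P : probability Omega R) (X : {RV P >-> nat}) :
  trivIset setT (fun k => X @^-1` [set k]).
Proof. by move=> i j _ _ [w [<- <-]]. Qed.

Lemma integral_natRV_fiber (d : measure_display) (Omega : measurableType d)
    (R : realType) (P : probability Omega R) (X : {RV P >-> nat}) (c h : R ^nat) :
  (forall k, P (X @^-1` [set k]) = (c k)%:E) ->
  forall k, (\int[P]_(w in X @^-1` [set k]) (h (X w))%:E = (c k * h k)%:E)%E.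
Proof.
move=> Xc k; have mk : measurable (X @^-1` [set k]).
  by rewrite -[X in measurable X]setTI; exact: measurable_funP.
rewrite (eq_integral (cst (h k)%:E)); last by move=> w /set_mem /= ->.
by rewrite integral_cst// mulrC EFinM; congr (_ * _)%E; exact: Xc.
Qed.

Lemma expectation_natRV_ge0 (d : measure_display) (Omega : measurableType d)
    (R : realType) (P : probability Omega R) (X : {RV P >-> nat}) (c h : R ^nat) :
  (forall k, P (X @^-1` [set k]) = (c k)%:E) -> (forall k, 0 <= h k) ->
  ('E_P[fun w => h (X w)] = \sum_(0 <= k <oo) (c k * h k)%:E)%E.
Proof.
move=> Xc h0; rewrite unlock -(bigcup_natRV X) ge0_integral_bigcup.
- by apply: eq_eseriesr => k _; exact: integral_natRV_fiber.
- by move=> k; rewrite -[X in measurable X]setTI; exact: measurable_funP.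
- by rewrite bigcup_natRV; apply/measurable_EFinP; exact: measurable_natRV_comp.
- by move=> w _; rewrite lee_fin.
- exact: trivIset_natRV.
Qed.

(** Absolute convergence is integrability, by the nonnegative case applied to [|h|]; the integral is
    then additive over the countably many fibres. *)
Lemma expectation_natRV (d : measure_display) (Omega : measurableType d)
    (R : realType) (P : probability Omega R) (X : {RV P >-> nat}) (c h : R ^nat) :
  (forall k, P (X @^-1` [set k]) = (c k)%:E) ->
  cvgn (series (fun k => `|c k * h k|)) ->
  ('E_P[fun w => h (X w)] = (limn (series (fun k => c k * h k)))%:E)%E.
Proof.
move=> Xc ch; have c0 k : 0 <= c k by rewrite -lee_fin -Xc.
rewrite unlock -(bigcup_natRV X) integral_bigcup.
- under eq_eseriesr do rewrite (integral_natRV_fiber h Xc).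
  rewrite -EFin_lim; last exact: normed_cvg.
  by apply/congr_lim/funext => n /=; rewrite sumEFin.
- exact: trivIset_natRV.
- by move=> k; rewrite -[X in measurable X]setTI; exact: measurable_funP.
- rewrite bigcup_natRV; apply/integrableP; split.
    by apply/measurable_EFinP; exact: measurable_natRV_comp.
  have := expectation_natRV_ge0 (h := fun k => `|h k|) Xc (fun k => normr_ge0 _).
  rewrite unlock => /= ->.
  under eq_eseriesr do rewrite -[X in X * _](ger0_norm (c0 _)) -normrM.
  by rewrite cvg_series_nneseries// ltry.
Qed.

(** * The hazard mass function and its survival products *)

Lemma prodrhoS (R : realType) (rho : R ^nat) (k : nat) :
  prodrho rho k.+1 = prodrho rho k * rho k.+1.
Proof. by rewrite /prodrho big_nat_recr. Qed.

(** This lets a finite horizon be treated as an infinite one whose terms are eventually zero. *)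
Definition horizon_zero (R : realType) (T : option nat) (rho : R ^nat) : Prop :=
  forall N, T = Some N -> forall k, (N <= k)%N -> prodrho rho k = 0.

(** The factor [rho N = 0] occurs in the product only for [N >= 1]; for [N = 0] the empty product
    would be 1. *)
Lemma prodrho_horizon (R : realType) (T : option nat) (rho : R ^nat) :
  T <> Some 0%N -> (forall N, T = Some N -> rho N = 0) -> horizon_zero T rho.
Proof.
move=> T0 rhoT N TN k; have N0 : (0 < N)%N by case: N TN => // /T0.
elim: k => [|k ih]; first by rewrite leqNgt N0.
rewrite leq_eqVlt prodrhoS => /predU1P[<-|Nk]; first by rewrite rhoT// mulr0.
by rewrite ih// mul0r.
Qed.

Lemma hazard_pmfS (R : realType) (T : option nat) (rho : R ^nat) (k : nat) :
  horizon_zero T rho ->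
  hazard_pmf T rho k.+1 = prodrho rho k - prodrho rho k.+1.
Proof.
move=> hz; rewrite /hazard_pmf/= prodrhoS.
have [_|kT] := boolP (upto T k.+1); first by rewrite /prodrho; ring.
case: T hz kT => [N|//] hz /=; rewrite -ltnNge ltnS => Nk.
by rewrite (hz N)// mul0r subrr.
Qed.

(** The limit 0 comes from the total mass: the mass function sums to the expectation of the constant
    1, and the products are 1 minus its partial sums. *)
Lemma survival_hazard (d : measure_display) (Omega : measurableType d)
    (R : realType) (P : probability Omega R) (T : option nat) (rho : R ^nat)
    (X : {RV P >-> nat}) :
  horizon_zero T rho ->
  (forall k : nat, P (X @^-1` [set k]) = (hazard_pmf T rho k)%:E) ->
  survival (hazard_pmf T rho) (prodrho rho).
Proof.
move=> hz Xc; have c0 k : 0 <= hazard_pmf T rho k by rewrite -lee_fin -Xc.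
have S0 : prodrho rho 0 = 1 by rewrite /prodrho big_geq.
split => // [k|]; first exact: hazard_pmfS.
have E1 := expectation_natRV_ge0 (h := fun=> 1) Xc (fun=> ler01).
rewrite (expectation_cst P 1) in E1.
have cc : cvgn (series (fun k => hazard_pmf T rho k * 1)).
  by apply: nneseries_cvg_series => [k|]; rewrite ?mulr_ge0// -E1 ltry.
have [] : 1%:E = (limn (series (fun k => hazard_pmf T rho k * 1)))%:E.
  by rewrite -cvg_series_nneseries// => k; rewrite mulr_ge0.
move=> L; move: (cc); rewrite -L => {}cc.
have -> : prodrho rho = (fun n => 1 - series (fun k => hazard_pmf T rho k * 1) n.+1).
  apply/funext => n; rewrite /series/=.
  elim: n => [|n ih]; first by rewrite big_nat1 /hazard_pmf/= mul0r subr0.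
  by rewrite big_nat_recr//= opprD addrA -ih hazard_pmfS// mulr1 subKr.
rewrite -[X in _ --> X](subrr 1); apply: cvgB; first exact: cvg_cst.
by rewrite cvg_shiftS.
Qed.

(** * Sums up to the horizon as limits *)

(** For finite [T] the partial sums are constant from [N] on, so both kinds of horizon are handled
    by one limit. *)
Lemma hsum_lim (R : realType) (T : option nat) (m : nat) (F : R ^nat) (l : \bar R) :
  (forall N, T = Some N -> forall k, (N <= k)%N -> (m <= k)%N -> F k = 0) ->
  (\sum_(m <= k < n) F k)%:E @[n --> \oo] --> l -> hsum T m F = l.
Proof.
case: T => [N|] FT Fl; rewrite /hsum; last first.
  rewrite -(cvg_lim _ Fl)//; apply/congr_lim/funext => n /=.
  by rewrite sumEFin.
have Fc : (\sum_(m <= k < n) F k)%:E @[n --> \oo] --> (\sum_(m <= k < N) F k)%:E.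
  apply: cvg_near_cst; near=> n; congr (_%:E).
  have Nn : (N <= n)%N by near: n; exact: nbhs_infty_ge.
  have [mN|Nm] := leqP m N.
    have F0 : \sum_(N <= k < n) F k = 0.
      rewrite big_nat big1// => k /andP[Nk _].
      by apply: (FT N) => //; exact: leq_trans Nk.
    by rewrite (big_cat_nat mN)//= F0 addr0.
  rewrite [RHS]big_geq ?(ltnW Nm)// big_nat big1// => k /andP[mk _].
  by apply: (FT N) => //; rewrite (leq_trans (ltnW Nm)).
exact: (cvg_unique _ Fc Fl).
Unshelve. all: by end_near. Qed.

(* The general term of the transformed series is [(h k.+1 - h k) * S k]; the
   terms [0 < k < n - 1] vanish and [k = n - 1] contributes [h n * S n.-1]. *)
Lemma hsum_abel (R : realType) (T : option nat) (rho h F : R ^nat) (n : nat)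
    (v b : R) (l : \bar R) :
  horizon_zero T rho -> (0 < n)%N -> (forall k, (0 < k < n)%N -> h k = 0) ->
  (forall k, (n <= k)%N -> F k = (h k.+1 - h k) * prodrho rho k) ->
  h 1%N = v -> (if (2 <= n)%N then h n * prodrho rho n.-1 else 0) = b ->
  (h 1%N + \sum_(1 <= k < N) (h k.+1 - h k) * prodrho rho k)%:E @[N --> \oo] --> l ->
  (l \is a fin_num -> hcvg T n F) /\ l = (hsum T n F + b%:E + v%:E)%E.
Proof.
move=> hz n0 hn Fh <- <- hl; set b' := if _ then _ else _.
have partial N : (n <= N)%N -> h 1%N + \sum_(1 <= k < N) (h k.+1 - h k) * prodrho rho k =
    \sum_(n <= k < N) F k + (b' + h 1%N).
  move=> nN; rewrite addrA addrC; congr +%R.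
  rewrite (big_cat_nat (n := n))//= addrC; congr +%R.
    by apply: eq_big_nat => k /andP[nk _]; rewrite Fh.
  rewrite /b'; case: ifPn => n2; last first.
    by rewrite big_geq// leqNgt.
  case: n n2 {n0 Fh nN b'} hn => // n n1 hn; rewrite big_nat_recr//=.
  rewrite (hn n); last by rewrite ltnSn andbT.
  rewrite subr0 big_nat big1 ?add0r// => k /andP[k0 kn].
  by rewrite !hn ?subrr ?mul0r//; rewrite ?k0 ?ltnS//= ltnW.
have lF : (\sum_(n <= k < N) F k)%:E @[N --> \oo] --> (l - (b' + h 1%N)%:E)%E.
  have : ((h 1%N + \sum_(1 <= k < N) (h k.+1 - h k) * prodrho rho k)%:E -
      (b' + h 1%N)%:E)%E @[N --> \oo] --> (l - (b' + h 1%N)%:E)%E.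
    by apply: cvgeB => //; [exact: fin_num_adde_defl|exact: cvg_cst].
  apply: cvg_trans; apply: near_eq_cvg; near=> N.
  by rewrite partial ?EFinD ?addeK//; near: N; exact: nbhs_infty_ge.
(* A finite limit in the extended reals is a limit of reals, which is the convergence that [hcvg]
   asks for. *)
split.
  move=> lfin _; apply/cvg_ex; exists (fine l - (b' + h 1%N)).
  by move: lF; rewrite -[X in (X - _)%E](fineK lfin) -EFinB => /fine_cvg.
have -> : hsum T n F = (l - (b' + h 1%N)%:E)%E.
  by apply: hsum_lim lF => N TN k Nk nk; rewrite Fh// (hz N)// mulr0.
by rewrite -addeA -[(b'%:E + _)%E]EFinD subeK.
Unshelve. all: by end_near. Qed.

Lemma expectation_abel_nondecreasing (d : measure_display)
    (Omega : measurableType d) (R : realType) (P : probability Omega R)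
    (T : option nat) (rho : R ^nat) (X : {RV P >-> nat}) (h F : R ^nat) (n : nat)
    (v b : R) :
  horizon_zero T rho ->
  (forall k : nat, P (X @^-1` [set k]) = (hazard_pmf T rho k)%:E) ->
  (0 < n)%N -> (forall k, (0 < k < n)%N -> h k = 0) ->
  (forall k, (n <= k)%N -> F k = (h k.+1 - h k) * prodrho rho k) ->
  h 1%N = v -> (if (2 <= n)%N then h n * prodrho rho n.-1 else 0) = b ->
  (forall k, 0 <= h k) -> (forall k, h k <= h k.+1) ->
  ('E_P[fun w => h (X w)] = hsum T n F + b%:E + v%:E)%E.
Proof.
move=> hz Xc n0 hn Fh hv hb h0 hh.
have cS := survival_hazard hz Xc.
rewrite (expectation_natRV_ge0 Xc h0).
by have [] := hsum_abel hz n0 hn Fh hv hb (abel_nondecreasing cS h0 hh).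
Qed.

Lemma expectation_abel_dominated (d : measure_display)
    (Omega : measurableType d) (R : realType) (P : probability Omega R)
    (T : option nat) (rho : R ^nat) (X : {RV P >-> nat}) (h F : R ^nat) (n : nat)
    (v b r C : R) :
  horizon_zero T rho ->
  (forall k : nat, P (X @^-1` [set k]) = (hazard_pmf T rho k)%:E) ->
  (0 < n)%N -> (forall k, (0 < k < n)%N -> h k = 0) ->
  (forall k, (n <= k)%N -> F k = (h k.+1 - h k) * prodrho rho k) ->
  h 1%N = v -> (if (2 <= n)%N then h n * prodrho rho n.-1 else 0) = b ->
  0 <= r -> cvgn (pseries (hazard_pmf T rho) r) ->
  (forall k, `|h k| <= C * r ^+ k) ->
  [/\ hcvg T n F,
      ('E_P[fun w => h (X w)] = (limn (series (fun k => hazard_pmf T rho k * h k)))%:E)%E &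
      ('E_P[fun w => h (X w)] = hsum T n F + b%:E + v%:E)%E].
Proof.
move=> hz Xc n0 hn Fh hv hb r0 cr hC.
have cS := survival_hazard hz Xc; have [_ _ _ c0 _] := cS.
have [cN _] := cvg_series_dominated c0 r0 cr hC.
have lim : (h 1%N + \sum_(1 <= k < N) (h k.+1 - h k) * prodrho rho k)%:E
    @[N --> \oo] --> (limn (series (fun k => hazard_pmf T rho k * h k)))%:E.
  by apply: cvg_EFin; [exact: nearW|exact: abel_dominated cS r0 cr hC].
rewrite (expectation_natRV Xc cN).
by have [/(_ isT)] := hsum_abel hz n0 hn Fh hv hb lim.
Qed.

(** * Finite generating functions and convergent power series *)

Lemma cvg_pseries_pgf (d : measure_display) (Omega : measurableType d)
    (R : realType) (P : probability Omega R) (T : option nat) (rho : R ^nat)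
    (X : {RV P >-> nat}) (r : R) :
  (forall k : nat, P (X @^-1` [set k]) = (hazard_pmf T rho k)%:E) ->
  0 <= r -> (T = None -> (pgf P X r < +oo)%E) ->
  cvgn (pseries (hazard_pmf T rho) r).
Proof.
move=> Xc r0; have c0 k : 0 <= hazard_pmf T rho k by rewrite -lee_fin -Xc.
case: T Xc c0 => [N _ _ _|Xc c0 /(_ erefl)]; last first.
  rewrite /pgf (expectation_natRV_ge0 (h := fun k => r ^+ k) Xc) => [cr|k].
    by apply: nneseries_cvg_series cr => k; rewrite mulr_ge0// exprn_ge0.
  by rewrite exprn_ge0.
apply/cvg_ex; exists (\sum_(0 <= k < N.+1) hazard_pmf (Some N) rho k * r ^+ k).
apply: cvg_near_cst; near=> n; rewrite /pseries /series/=.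
have Nn : (N.+1 <= n)%N by near: n; exact: nbhs_infty_ge.
have tail : \sum_(N.+1 <= k < n) hazard_pmf (Some N) rho k * r ^+ k = 0.
  rewrite big_nat big1// => k /andP[Nk _].
  by rewrite /hazard_pmf /= (leqNgt k) Nk andbF mul0r.
by rewrite (big_cat_nat (n := N.+1))//= tail addr0.
Unshelve. all: by end_near. Qed.

Lemma mmt_gen_fun_pgf (d : measure_display) (Omega : measurableType d)
    (R : realType) (P : probability Omega R) (X : {RV P >-> nat}) (u : R) :
  ('M_P (fun w => (X w)%:R : R) u = pgf P X (expR u))%E.
Proof.
rewrite /pgf /mmt_gen_fun; congr expectation.
by apply/funext => w /=; rewrite -expRM_natr mulrC.
Qed.

Lemma near_lt_exists (R : realType) (Q : R -> Prop) (t : R) :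
  (\forall u \near t, Q u) -> exists2 u, t < u & Q u.
Proof.
move=> tQ; have tQ' : \forall u \near t^'+, Q u.
  by apply: cvg_within tQ.
have tt : \forall u \near t^'+, t < u := nbhs_right_gt t.
by have [u [? ?]] := filter_ex (filterI tt tQ'); exists u.
Qed.

(** A neighbourhood of [z] contains points of larger modulus: to the right if [z >= 0], to the left
    otherwise, the latter case by reflection. *)
Lemma near_normr_lt_exists (R : realType) (Q : R -> Prop) (z : R) :
  (\forall u \near z, Q `|u|) -> exists2 r, `|z| < r & Q r.
Proof.
move=> zQ; have [z0|z0] := leP 0 z.
  have [u zu Qu] := near_lt_exists zQ.
  by exists `|u| => //; rewrite (ger0_norm z0) ger0_norm// (le_trans z0)// ltW.
have [|u zu Qu] := @near_lt_exists R (fun u => Q `|- u|) (- z).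
  have : -%R u @[u --> - z] --> - - z := @oppr_continuous R R (- z).
  rewrite opprK.
  by move=> /(_ [set u | Q `|u|] zQ).
exists `|- u| => //; rewrite normrN (ltr0_norm z0) gtr0_norm//.
by rewrite (lt_trans _ zu)// oppr_gt0.
Qed.

(** * Falling factorials and derivatives of the identity *)

(** The discrete analogue of the power rule; it supplies both the increments and the monotonicity
    used for the factorial moments. *)
Lemma ffactS_add (n k : nat) : (k.+1 ^_ n.+1 = k ^_ n.+1 + n.+1 * k ^_ n)%N.
Proof.
rewrite ffactSS ffactnSr; have [kn|nk] := ltnP k n.
  by rewrite ffact_small// !muln0.
by rewrite (mulnC (k ^_ n)) -mulnDl addnS subnK.
Qed.

Lemma leq_ffact_exp (n k : nat) : (k ^_ n <= k ^ n)%N.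
Proof.
elim: n => [|n ih]; first by rewrite ffactn0.
by rewrite ffactnSr expnSr leq_mul// leq_subr.
Qed.

Lemma prodr_subn_ffact (R : pzRingType) (n k : nat) :
  \prod_(i < n) (k%:R - i%:R) = (k ^_ n)%:R :> R.
Proof.
elim: n => [|n ih]; first by rewrite big_ord0.
rewrite big_ord_recr/= ih ffactnSr natrM; have [nk|kn] := leqP n k.
  by rewrite natrB.
by rewrite ffact_small// !mul0r.
Qed.

Lemma ffact_natr (R : numFieldType) (n k : nat) : (n <= k)%N ->
  (k ^_ n)%:R = k`!%:R / (k - n)`!%:R :> R.
Proof.
by move=> nk; rewrite -(ffact_fact nk) natrM mulfK.
Qed.

(** The falling factorial is at most [k ^ n], and lowering the exponent by [n] costs [y ^- n]; the
    base [y > |z|] is positive even for [z = 0]. *)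
Lemma ffact_exp_le (R : realFieldType) (z r : R) (n : nat) : `|z| < r ->
  exists C, forall k, `|(k ^_ n)%:R * z ^+ (k - n)| <= C * r ^+ k.
Proof.
move=> zr; pose y := (`|z| + r) / 2.
have zy : `|z| < y by rewrite /y; lra.
have yr : y < r by rewrite /y; lra.
have y0 : 0 < y := le_lt_trans (normr_ge0 z) zy.
have [C HC] := natexp_exp_le n (ltW y0) yr; exists (y ^- n * C) => k.
have [kn|nk] := ltnP k n.
  rewrite ffact_small// mul0r normr0 -mulrA mulr_ge0 ?invr_ge0 ?exprn_ge0 ?(ltW y0)//.
  by apply: le_trans (HC k); rewrite mulr_ge0// exprn_ge0// ltW.
rewrite normrM normr_nat normrX -mulrA.
apply: le_trans (ler_wpM2l _ (HC k)); last by rewrite invr_ge0 exprn_ge0// ltW.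
rewrite mulrCA; apply: ler_pM => //.
- by rewrite -natrX ler_nat leq_ffact_exp.
- rewrite -{2}(subnK nk) exprD mulrCA mulVf ?mulr1 ?expf_neq0 ?gt_eqF//.
  by apply: lerXn2r => //; rewrite ?nnegrE// ltW.
Qed.

Lemma derive1n_id (R : realType) (n : nat) (z : R) :
  derive1n n.+1 (fun x : R => x) z = (n == 0%N)%:R.
Proof.
have cst0 m : derive1n m (cst 0 : R -> R) = cst 0.
  by elim: m => // m ih; rewrite derive1nS ih; apply/funext => x; rewrite derive1_cst.
rewrite derive1Sn.
have -> : derive1 (fun x : R => x) = cst 1.
  by apply/funext => x; rewrite derive1E derive_id.
case: n => [//|n]; rewrite derive1Sn.
have -> : derive1 (cst 1 : R -> R) = cst 0.
  by apply/funext => x; rewrite derive1_cst.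
by rewrite cst0.
Qed.

(** * Radius of convergence, and derivatives as expectations *)

(** It moves the condition [T = None] under the filter, so that a point beyond the given one can be
    chosen before the horizon is known. *)
Lemma near_imply (T : Type) (F : set_system T) (Q : Prop) (A : T -> Prop) :
  Filter F -> (Q -> \forall u \near F, A u) -> \forall u \near F, Q -> A u.
Proof.
move=> FF QA; have [q|nq] := pselect Q; first by apply: filterS (QA q).
by apply: nearW => u /nq.
Qed.

Lemma mmt_gen_fun_natE (d : measure_display) (Omega : measurableType d)
    (R : realType) (P : probability Omega R) (X : {RV P >-> nat}) (t : R) :
  ('M_P (fun w => (X w)%:R : R) t = 'E_P[fun w => expR (t * (X w)%:R)%R])%E.
Proof. by congr expectation; apply/funext => w /=; rewrite mulrC. Qed.

Lemma mgf_radius (d : measure_display) (Omega : measurableType d)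
    (R : realType) (P : probability Omega R) (T : option nat) (rho : R ^nat)
    (X : {RV P >-> nat}) (t : R) :
  (forall k : nat, P (X @^-1` [set k]) = (hazard_pmf T rho k)%:E) ->
  (T = None -> \forall u \near t, ('M_P (fun w => (X w)%:R : R) u < +oo)%E) ->
  exists2 r, expR t < r & cvgn (pseries (hazard_pmf T rho) r).
Proof.
move=> Xc /near_imply/near_lt_exists[u tu uT]; exists (expR u).
  by rewrite ltr_expR.
apply: (cvg_pseries_pgf Xc (expR_ge0 u)) => /uT.
by rewrite mmt_gen_fun_pgf.
Qed.

Lemma pgf_radius (d : measure_display) (Omega : measurableType d)
    (R : realType) (P : probability Omega R) (T : option nat) (rho : R ^nat)
    (X : {RV P >-> nat}) (z : R) :
  (forall k : nat, P (X @^-1` [set k]) = (hazard_pmf T rho k)%:E) ->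
  (T = None -> \forall u \near z, (pgf P X `|u| < +oo)%E) ->
  exists2 r, `|z| < r & cvgn (pseries (hazard_pmf T rho) r).
Proof.
move=> Xc /near_imply.
move=> /(@near_normr_lt_exists R (fun r => T = None -> (pgf P X r < +oo)%E)).
move=> [r zr rT]; exists r => //; apply: cvg_pseries_pgf rT => //.
by rewrite (le_trans _ (ltW zr)).
Qed.

Lemma norm_natexp_expR_le (R : realType) (t r : R) (n : nat) : expR t < r ->
  exists C, forall k : nat, `|k%:R ^+ n * expR (t * k%:R)| <= C * r ^+ k.
Proof.
move=> tr; have [C HC] := natexp_exp_le n (expR_ge0 t) tr; exists C => k.
by rewrite expRM_natr ger0_norm// mulr_ge0 ?exprn_ge0// expR_ge0.
Qed.

Lemma derive1n_mgf (d : measure_display) (Omega : measurableType d)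
    (R : realType) (P : probability Omega R) (T : option nat) (rho : R ^nat)
    (X : {RV P >-> nat}) (n : nat) (t r : R) :
  (forall k : nat, P (X @^-1` [set k]) = (hazard_pmf T rho k)%:E) ->
  expR t < r -> cvgn (pseries (hazard_pmf T rho) r) ->
  let M := (fun u : R => fine ('M_P (fun w => (X w)%:R : R) u)%E) in
  derivable (derive1n n M) t 1 /\
  (derive1n n M t)%:E = ('E_P[fun w => ((X w)%:R ^+ n * expR (t * (X w)%:R))%R])%E.
Proof.
move=> Xc tr cr M; have c0 k : 0 <= hazard_pmf T rho k by rewrite -lee_fin -Xc.
have r0 : 0 <= r := le_trans (expR_ge0 t) (ltW tr).
have EX m u : expR u < r -> ('E_P[fun w => ((X w)%:R ^+ m * expR (u * (X w)%:R))%R] =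
    (limn (series (fun k => hazard_pmf T rho k * (k%:R ^+ m * expR (u * k%:R)))))%:E)%E.
  move=> ur; have [C HC] := norm_natexp_expR_le m ur.
  have [cN _] := cvg_series_dominated c0 r0 cr HC.
  exact: (expectation_natRV (h := fun k => k%:R ^+ m * expR (u * k%:R)) Xc cN).
have [||-> dM] := @derive1n_series_expR R (hazard_pmf T rho) M r n t c0 _ _ tr.
- by move=> y yr; apply: is_cvg_pseries_inside cr _; rewrite (ger0_norm r0).
- move=> u ur; rewrite /M mmt_gen_fun_natE.
  have := EX 0%N u ur.
  under eq_fun do rewrite mul1r.
  by under [in X in _ = X -> _]eq_fun do rewrite mul1r; move=> ->.
by split=> //; rewrite EX.
Qed.

Lemma derive1n_pgf (d : measure_display) (Omega : measurableType d)
    (R : realType) (P : probability Omega R) (T : option nat) (rho : R ^nat)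
    (X : {RV P >-> nat}) (n : nat) (z r : R) :
  (forall k : nat, P (X @^-1` [set k]) = (hazard_pmf T rho k)%:E) ->
  `|z| < r -> cvgn (pseries (hazard_pmf T rho) r) ->
  let PX := (fun u : R => fine (pgf P X u)) in
  derivable (derive1n n PX) z 1 /\
  (derive1n n PX z)%:E = ('E_P[fun w => (((X w) ^_ n)%:R * z ^+ (X w - n)%N)%R])%E.
Proof.
move=> Xc zr cr PX; have c0 k : 0 <= hazard_pmf T rho k by rewrite -lee_fin -Xc.
have r0 : 0 <= r := le_trans (normr_ge0 z) (ltW zr).
have EX (h : R ^nat) (C : R) : (forall k, `|h k| <= C * r ^+ k) ->
    ('E_P[fun w => h (X w)] = (limn (series (fun k => hazard_pmf T rho k * h k)))%:E)%E.
  move=> HC; have [cN _] := cvg_series_dominated c0 r0 cr HC.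
  exact: expectation_natRV Xc cN.
have [||-> dM] := @derive1n_series_ffact R (hazard_pmf T rho) PX r n z _ _ zr.
- by move=> y yr; apply: is_cvg_pseries_inside cr _; rewrite (ger0_norm r0).
- move=> u ur; rewrite /PX /pgf (EX (fun k => u ^+ k) 1)// => k.
  by rewrite mul1r normrX; apply: lerXn2r => //; rewrite ?nnegrE// ltW.
split=> //; have [C HC] := ffact_exp_le n zr.
by rewrite (EX (fun k => (k ^_ n)%:R * z ^+ (k - n)) C).
Qed.

(** * The variance *)

(** The second moment may be infinite, so the square is expanded without subtraction, as
    [(Y - m)^2 + 2 m Y = Y^2 + m^2]; all terms are nonnegative and expectation is additive in the
    extended reals. *)
Lemma variance_natRV (d : measure_display) (Omega : measurableType d)
    (R : realType) (P : probability Omega R) (X : {RV P >-> nat}) :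
  let Y := (fun w => (X w)%:R) : Omega -> R in
  ('E_P[Y] < +oo -> 'V_P[Y] = 'E_P[fun w => (Y w ^+ 2)%R] - 'E_P[Y] ^+ 2)%E.
Proof.
move=> Y Yoo; have Y0 : (0 <= 'E_P[Y])%E by apply: expectation_ge0 => w; rewrite ler0n.
have Yfin : ('E_P[Y])%E \is a fin_num by rewrite ge0_fin_numE.
rewrite /variance unlock; set m := (fine 'E_P[Y])%E.
have m0 : 0 <= m by rewrite fine_ge0.
have Ym : ('E_P[Y] = m%:E)%E by rewrite fineK.
have mh (h : R ^nat) : measurable_fun setT (fun w => (h (X w))%:E).
  by apply/measurable_EFinP; exact: (measurable_natRV_comp X h).
have lin (h g : R ^nat) (a : R) : (forall k, 0 <= h k) -> (forall k, 0 <= g k) ->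
    0 <= a -> ('E_P[fun w => (h (X w) + a * g (X w))%R] =
               'E_P[fun w => h (X w)] + a%:E * 'E_P[fun w => g (X w)])%E.
  move=> h0 g0 a0; rewrite unlock.
  under eq_integral do rewrite EFinD EFinM.
  rewrite ge0_integralD//.
  - by rewrite ge0_integralZl//= => w _; rewrite lee_fin.
  - by move=> w _; rewrite lee_fin.
  - by move=> w _; rewrite -EFinM lee_fin mulr_ge0.
  - by apply: measurable_funeM.
have := lin (fun k => (k%:R - m) ^+ 2) (fun k => k%:R) (2 * m)
  (fun k => sqr_ge0 _) (fun k => ler0n _ k).
have := lin (fun k => k%:R ^+ 2) (fun=> 1) (m ^+ 2)
  (fun k => sqr_ge0 _) (fun k => ler01) (sqr_ge0 m).
rewrite (expectation_cst P 1) mule1 -/Y Ym => E1.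
move=> /(_ (mulr_ge0 (ler0n R 2) m0)) E2.
move: E2; have -> : (fun w => ((X w)%:R - m) ^+ 2 + 2 * m * (X w)%:R) =
  (fun w => (X w)%:R ^+ 2 + m ^+ 2 * 1) by apply/funext => w; ring.
rewrite E1 => E2.
have -> : ('E_P[((Y \- cst m) * (Y \- cst m))%R] =
    'E_P[fun w => (((X w)%:R - m) ^+ 2)%R])%E.
  by congr expectation; apply/funext => w; rewrite expr2.
(* The finite number [2 * m * m] is added and subtracted so that the expanded identity applies. *)
have -> : ('E_P[fun w => (((X w)%:R - m) ^+ 2)%R] =
    'E_P[fun w => (((X w)%:R - m) ^+ 2)%R] + (2 * m)%:E * m%:E - (2 * m)%:E * m%:E)%E.
  by rewrite -EFinM addeK.
rewrite -E2 expe2 -!EFinM -addeA -EFinB; congr (_ + _)%E.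
by rewrite -EFinN; congr (_%:E); ring.
Qed.

(** The increment of the square is [1 + 2 k]; nonnegativity allows the series to be split even if it
    diverges. *)
Lemma hsum_sqr_diff (R : realType) (T : option nat) (S : R ^nat) :
  (forall k, 0 <= S k) ->
  (hsum T 1 (fun k => (k.+1%:R ^+ 2 - k%:R ^+ 2) * S k)%R =
   hsum T 1 S + 2%:E * hsum T 1 (fun k => k%:R * S k)%R)%E.
Proof.
move=> S0.
have E k : (k.+1%:R ^+ 2 - k%:R ^+ 2) * S k = S k + 2 * (k%:R * S k).
  by rewrite -natr1; ring.
have kS0 k : (0 <= (k%:R * S k)%:E)%E by rewrite lee_fin mulr_ge0.
case: T => [N|]; rewrite /hsum.
  rewrite -EFinM -EFinD mulr_sumr -big_split/=.
  by congr (_%:E); apply: eq_bigr => k _; exact: E.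
under eq_eseriesr do rewrite E EFinD EFinM.
rewrite nneseriesD ?nneseriesZl// => k _ _; first by rewrite lee_fin.
by rewrite mule_ge0// lee_fin.
Qed.

(** * The formulas for generating functions and moments *)

Theorem proposition2p3 (d : measure_display) (Omega : measurableType d)
    (R : realType) (P : probability Omega R)
    (T : option nat) (rho : nat -> R) (X : {RV P >-> nat})
    (T_gt0 : T <> Some 0%N)
    (rho_itv : forall k : nat, (1 <= k)%N -> before T k -> 0 < rho k <= 1)
    (rho_last : forall N : nat, T = Some N -> rho N = 0)
    (X_pmf : forall k : nat, P (X @^-1` [set k]) = (hazard_pmf T rho k)%:E) :
  let Y := (fun w => (X w)%:R) : Omega -> R in
  let M := (fun t => fine ('M_P Y t)) : R -> R in
  let PX := (fun z => fine (pgf P X z)) : R -> R in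
  let S := prodrho rho in
  (* moment generating function *)
  (forall t : R,
     'M_P Y t = (hsum T 1 (fun k => (expR (t * k.+1%:R) - expR (t * k%:R)) * S k)%R
                 + (expR t)%:E)%E) /\
  (* its derivatives *)
  (forall (n : nat) (t : R), (1 <= n)%N ->
     (T = None -> \forall u \near t, ('M_P Y u < +oo)%E) ->
     let F := fun k : nat => (k.+1%:R ^+ n * expR (t * k.+1%:R)
                              - k%:R ^+ n * expR (t * k%:R)) * S k in
     [/\ derivable (derive1n n.-1 M) t 1,
         hcvg T 1 F &
         (derive1n n M t)%:E = (hsum T 1 F + (expR t)%:E)%E]) /\
  (* moments *)
  (forall n : nat, (1 <= n)%N ->
     ((T = None -> \forall u \near (0 : R), ('M_P Y u < +oo)%E) ->
      ('E_P[fun w => (Y w ^+ n)%R])%E = (derive1n n M 0)%:E) /\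
     ('E_P[fun w => (Y w ^+ n)%R])%E
       = (hsum T 1 (fun k => (k.+1%:R ^+ n - k%:R ^+ n) * S k)%R + 1)%E) /\
  (* mean and variance *)
  ('E_P[Y])%E = (hsum T 1 S + 1)%E /\
  ((T = None -> ('E_P[Y] < +oo)%E) ->
     ('V_P[Y])%E = ('E_P[Y] + 2%:E * hsum T 1 (fun k => k%:R * S k)%R
                    - 'E_P[Y] ^+ 2)%E) /\
  (* probability generating function *)
  (forall z : R, (T = None -> (pgf P X `|z| < +oo)%E) ->
     let F := fun k : nat => (z ^+ k.+1 - z ^+ k) * S k in
     hcvg T 1 F /\ pgf P X z = (hsum T 1 F + z%:E)%E) /\
  (* its derivatives *)
  (forall (n : nat) (z : R), (1 <= n)%N ->
     (T = None -> \forall u \near z, (pgf P X `|u| < +oo)%E) ->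
     let F := fun k : nat =>
       ((k.+1)`!%:R * z ^+ (k.+1 - n) / (k.+1 - n)`!%:R
        - k`!%:R * z ^+ (k - n) / (k - n)`!%:R) * S k in
     [/\ derivable (derive1n n.-1 PX) z 1,
         hcvg T n F &
         (derive1n n PX z)%:E = (hsum T n F + (boundary_term rho n)%:E
                           + (derive1n n (fun x : R => x) z)%:E)%E]) /\
  (* factorial moments *)
  (forall n : nat, (1 <= n)%N ->
     ((T = None -> \forall u \near (1 : R), (pgf P X `|u| < +oo)%E) ->
      ('E_P[fun w => (\prod_(i < n) (Y w - i%:R))%R])%E = (derive1n n PX 1)%:E) /\
     ('E_P[fun w => (\prod_(i < n) (Y w - i%:R))%R])%E
       = (hsum T n (fun k => k`!%:R * n%:R / (k.+1 - n)`!%:R * S k)%R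
          + (boundary_term rho n)%:E
          + (derive1n n (fun x : R => x) 1)%:E)%E).
Proof.
move=> Y M PX S; have hz := prodrho_horizon T_gt0 rho_last.
have cS := survival_hazard hz X_pmf.
have no_term (k : nat) (h : R ^nat) : (0 < k < 1)%N -> h k = 0 by case: k.
have moment n : (1 <= n)%N -> ('E_P[fun w => (Y w ^+ n)%R]
    = hsum T 1 (fun k => (k.+1%:R ^+ n - k%:R ^+ n) * S k)%R + 1)%E.
  move=> n0; rewrite (expectation_abel_nondecreasing (h := fun k => k%:R ^+ n)
    (F := fun k => (k.+1%:R ^+ n - k%:R ^+ n) * S k) (n := 1) (v := 1) (b := 0)
    hz X_pmf) ?adde0//.
  - by move=> k /(no_term _ (fun k => k%:R ^+ n)).
  - by rewrite expr1n.
  - by move=> k; apply: lerXn2r => //; rewrite ?nnegrE ?ler_nat.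
have mean : ('E_P[Y] = hsum T 1 S + 1)%E.
  have := moment 1%N isT.
  under eq_fun do rewrite expr1.
  move=> ->; congr (hsum T 1 _ + 1)%E; apply/funext => k.
  by rewrite !expr1 -natr1 addrAC subrr add0r mul1r.
split; last split; last split; last split; last split; last split; last split.
(* For [t >= 0] the exponentials are nondecreasing and the value may be infinite; for [t < 0] they
   decrease and are dominated with [r = 1]. *)
- move=> t; rewrite mmt_gen_fun_natE; have [t0|t0] := leP 0 t.
    rewrite (expectation_abel_nondecreasing (h := fun k => expR (t * k%:R))
      (F := fun k => (expR (t * k.+1%:R) - expR (t * k%:R)) * S k) (n := 1)
      (v := expR t) (b := 0) hz X_pmf) ?adde0//.
    + by move=> k /(no_term _ (fun k => expR (t * k%:R))).
    + by rewrite mulr1.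
    + by move=> k; rewrite ler_expR ler_wpM2l// ler_nat.
  have t1 : expR t < 1 by rewrite expR_lt1.
  have [C HC] := norm_natexp_expR_le 0 t1.
  (* At 1 the probability generating function is the total mass, hence finite. *)
  have c1 : cvgn (pseries (hazard_pmf T rho) 1).
    apply: (cvg_pseries_pgf X_pmf ler01) => _; rewrite /pgf.
    under eq_fun do rewrite expr1n.
    by rewrite (expectation_cst P 1) ltry.
  have [||||||_ _ ->] := expectation_abel_dominated (h := fun k => expR (t * k%:R))
      (F := fun k => (expR (t * k.+1%:R) - expR (t * k%:R)) * S k) (n := 1)
      (v := expR t) (b := 0) (C := C) hz X_pmf _ _ _ _ _ ler01 c1 _ => //.
  + by move=> k /(no_term _ (fun k => expR (t * k%:R))).
  + by rewrite mulr1.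
  + by move=> k; have := HC k; rewrite mul1r.
  + by rewrite adde0.
- move=> n t n0 /(mgf_radius X_pmf)[r tr cr] F.
  (* Differentiability at order [n - 1] certifies that the [n]-th derivative is not a default
     value. *)
  have [dM _] := derive1n_mgf n.-1 X_pmf tr cr.
  have [_ EM] := derive1n_mgf n X_pmf tr cr.
  have [C HC] := norm_natexp_expR_le n tr.
  have [|||||hF _ EF] := expectation_abel_dominated (F := F) (n := 1)
    (h := fun k => k%:R ^+ n * expR (t * k%:R)) (v := expR t) (b := 0) hz X_pmf
    _ _ _ _ _ (le_trans (expR_ge0 t) (ltW tr)) cr HC => //.
  + by move=> k /(no_term _ (fun k => k%:R ^+ n * expR (t * k%:R))).
  + by rewrite expr1n mul1r mulr1.
  + by split => //; rewrite EM EF adde0.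
- move=> n n0; split; last exact: moment.
  move=> /(mgf_radius X_pmf)[r tr cr]; have [_ ->] := derive1n_mgf n X_pmf tr cr.
  by congr expectation; apply/funext => w; rewrite mul0r expR0 mulr1.
- exact: mean.
- move=> YT; have Yoo : ('E_P[Y] < +oo)%E.
    (* For finite [T] the formula for the mean already shows that it is finite. *)
    by move: YT mean; case: (T) => [N _ ->|/(_ erefl)]//; rewrite /hsum -EFinD ltry.
  rewrite (variance_natRV Yoo) (moment 2%N)// mean; congr (_ - _)%E.
  rewrite addeAC; congr (_ + _)%E.
  exact: (hsum_sqr_diff T (survival_ge0 cS)).
- move=> z zT F; have cz := cvg_pseries_pgf X_pmf (normr_ge0 z) zT.
  have [||||||hF _ EF] := expectation_abel_dominated (F := F) (n := 1)
    (h := fun k => z ^+ k) (v := z) (b := 0) (C := 1) hz X_pmf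
    _ _ _ _ _ (normr_ge0 z) cz _ => //.
  + by move=> k /(no_term _ (fun k => z ^+ k)).
  + by move=> k; rewrite mul1r normrX.
  + by split => //; rewrite /pgf EF adde0.
- move=> n z n0 /(pgf_radius X_pmf)[r zr cr] F.
  have [dP _] := derive1n_pgf n.-1 X_pmf zr cr.
  have [_ EP] := derive1n_pgf n X_pmf zr cr.
  have [C HC] := ffact_exp_le n zr.
  have [|||||hF _ EF] := expectation_abel_dominated (F := F) (n := n)
    (h := fun k => (k ^_ n)%:R * z ^+ (k - n)) (v := derive1n n (fun x : R => x) z)
    (b := boundary_term rho n) hz X_pmf
    _ _ _ _ _ (le_trans (normr_ge0 z) (ltW zr)) cr HC => //.
  + by move=> k /andP[_ kn]; rewrite ffact_small// mul0r.
  + move=> k nk; rewrite /F !ffact_natr//; last exact: leqW.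
    by rewrite ![_ * z ^+ _ / _]mulrAC.
  (* The leading value [h 1] is 1 for [n = 1] and 0 for [n >= 2]: exactly the [n]-th derivative of
     the identity. *)
  + case: n n0 {dP EP HC F} => // n _; rewrite derive1n_id.
    by case: n => [|n]; rewrite ?ffactn1 ?mul1r// ffact_small// mul0r.
  + by rewrite /boundary_term subnn expr0 mulr1 ffactnn.
  + by split => //; rewrite EP EF.
- move=> n n0; split.
    move=> /(pgf_radius X_pmf)[r zr cr]; have [_ ->] := derive1n_pgf n X_pmf zr cr.
    by congr expectation; apply/funext => w; rewrite expr1n mulr1 prodr_subn_ffact.
  rewrite (_ : (fun w => _) = (fun w => ((X w) ^_ n)%:R)); last first.
    by apply/funext => w; rewrite prodr_subn_ffact.
  rewrite (expectation_abel_nondecreasing (h := fun k => (k ^_ n)%:R)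
    (F := fun k => k`!%:R * n%:R / (k.+1 - n)`!%:R * S k) (n := n)
    (v := derive1n n (fun x : R => x) 1) (b := boundary_term rho n) hz X_pmf)//.
  + by move=> k /andP[_ kn]; rewrite ffact_small.
  (* The increment of the falling factorial of order [n.+1] is [n.+1] times the one of order [n],
     that is [n.+1 * k! / (k - n)!]. *)
  + case: n n0 => // n _ k nk; congr (_ * _).
    rewrite ffactS_add natrD addrAC subrr add0r natrM subSS.
    by rewrite ffact_natr ?(ltnW nk)// mulrCA mulrA.
  + case: n n0 => // n _; rewrite derive1n_id.
    by case: n => [|n]; rewrite ?ffactn1// ffact_small.
  + by rewrite /boundary_term ffactnn.
  + by move=> k; case: n n0 => // n _; rewrite ler_nat ffactS_add leq_addr.
Qed.
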